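(* Let $\mathbf{X}\subseteq\mathbb{R}^n$ and let $\mu$ be a probability measure on $\mathbf{X}$ that is equivalent to Lebesgue measure $m$ on $\mathbf{X}$ (i.e. $\mu(A)=0$ if and only if $m(A)=0$ for every measurable $A\subset\mathbf{X}$). Let $\Psi(\mathbf{x})=(\psi_1(\mathbf{x}),\ldots,\psi_N(\mathbf{x}))^\top$ be basis functions in $\mathcal{L}_2(\mathbf{X},\mu)$ satisfying the $\mu$-independence property $$\mu\{\mathbf{x}:\mathbf{c}^\top\Psi(\mathbf{x})=0\}=0\quad\text{for all nonzero }\mathbf{c}\in\mathbb{R}^N,$$ and let $\mathbf{x}_1,\mathbf{x}_2,\ldots$ be independent, identically distributed samples from $\mu$. Let $\hat\phi_\lambda\in\mathcal{L}_2(\mathbf{X},\mu)$ be the path-integral approximation of the Koopman eigenfunction, and for each $L$ let $\tilde\phi_\lambda(\mathbf{x})=\Psi(\mathbf{x})^\top\mathbf{u}^\star$ with $\mathbf{u}^\star=\mathbf{G}^\dagger\mathbf{c}$ be the least-squares approximation built from the samples $\mathbf{x}_1,\ldots,\mathbf{x}_L$, i.e. $\mathbf{u}^\star$ solves $\min_{\mathbf{u}\in\mathbb{R}^N}\|\mathbf{G}\mathbf{u}-\mathbf{c}\|$ with $$\mathbf{c}=(\hat\phi_\lambda(\mathbf{x}_1),\ldots,\hat\phi_\lambda(\mathbf{x}_L))^\top,\qquad \mathbf{G}=(\Psi(\mathbf{x}_1),\ldots,\Psi(\mathbf{x}_L))^\top .$$ Then, with probability one, $$\tilde\phi_\lambda(\mathbf{x})\to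 P_N^\mu\hat\phi_\lambda(\mathbf{x})\quad\text{as }L\to\infty,$$ where $P_N^\mu$ is the $\mathcal{L}_2(\mathbf{X},\mu)$-orthogonal projection onto the span of $\psi_1,\ldots,\psi_N$.
   Context: The projection is $P_N^\mu\phi=\arg\min_{f\in\mathcal{F}_N}\|f-\phi\|_{\mathcal{L}_2(\mathbf{X},\mu)}=\Psi^\top(\mathbf{x})\arg\min_{\mathbf{c}\in\mathbb{R}^N}\int_{\mathbf{X}}|\mathbf{c}^\top\Psi(\mathbf{x})-\phi(\mathbf{x})|^2\,d\mu(\mathbf{x})$, where $\mathcal{F}_N=\mathrm{span}\{\psi_1,\ldots,\psi_N\}\subset\mathcal{L}_2(\mathbf{X},\mu)$. $\mathbf{G}^\dagger$ denotes the Moore–Penrose pseudoinverse and $\|\cdot\|$ the Euclidean norm. The real-valued function $\hat\phi_\lambda$ comes from the following construction. The system $\dot{\mathbf{x}}=\mathbf{f}(\mathbf{x})$ has flow $\mathbf{s}_t(\mathbf{x})$ and a hyperbolic equilibrium at the origin; $\mathbf{A}=\frac{\partial\mathbf{f}}{\partial\mathbf{x}}(0)$, $\mathbf{F}_n(\mathbf{x})=\mathbf{f}(\mathbf{x})-\mathbf{A}\mathbf{x}$, $\lambda$ is an eigenvalue of $\mathbf{A}$ with positive real part, and $\mathbf{w}_\lambda^\top$ is a left eigenvector of $\mathbf{A}$ for $\lambda$. Then $$\hat\phi_\lambda(\mathbf{x})=\mathbf{w}_\lambda^\top\mathbf{x}+\int_0^{t(\mathbf{x})}e^{-\lambda\tau}\mathbf{w}_\lambda^\top\mathbf{F}_n(\mathbf{s}_\tau(\mathbf{x}))\,d\tau,$$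 where $t(\mathbf{x})$ is a time at which the trajectory from $\mathbf{x}$ lies in a fixed $\epsilon$-neighborhood of the origin. Here $\hat\phi_\lambda$ is regarded as a given (everywhere-defined, measurable) element of $\mathcal{L}_2(\mathbf{X},\mu)$ evaluated at the sample points. Since $\mathcal{F}_N$ is finite-dimensional, convergence means convergence of the coefficient vectors with respect to $\Psi$ (equivalently, convergence in $\mathcal{L}_2(\mathbf{X},\mu)$, and pointwise in $\mathbf{x}$). *)

(* Defs.v *)
From HB Require Import structures.
From mathcomp Require Import all_boot all_order all_algebra.
From mathcomp Require Import complex finmap.
From mathcomp Require Import all_classical all_reals all_analysis.
Set Implicit Arguments.
Unset Strict Implicit.
Unset Printing Implicit Defensive.
Import Order.TTheory GRing.Theory Num.Theory.
Import numFieldNormedType.Exports.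

Local Open Scope classical_set_scope.
Local Open Scope ring_scope.

(* Points of R^n are row vectors (the convention of 'J), with the Borel
   sigma-algebra.  The topology is that of the sup norm, i.e. the usual one. *)
HB.instance Definition _ (R : realType) (n : nat) :=
  @isMeasurable.Build (sigma_display (@open 'rV[R]_n)) 'rV[R]_n
    <<s (@open 'rV[R]_n) >> (@sigma_algebra0 _ setT (@open 'rV[R]_n))
    (@sigma_algebraC _ (@open 'rV[R]_n))
    (@sigma_algebra_bigcup _ setT (@open 'rV[R]_n)).

Section lebesgue.
Context {R : realType} {n : nat}.

Definition box (a b : 'rV[R]_n) : set 'rV[R]_n :=
  [set x | forall i, a 0 i < x 0 i <= b 0 i].

Definition box_volume (a b : 'rV[R]_n) : R :=
  \prod_(i < n) Num.max 0 (b 0 i - a 0 i).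

(* n-dimensional Lebesgue measure, as the outer measure generated by the volume
   of boxes; only its values on Borel sets are used.  Meaningful for n > 0:
   when n = 0 no box is empty. *)
Definition lebesgue_rV (A : set 'rV[R]_n) : \bar R :=
  ereal_inf [set v | exists a b : nat -> 'rV[R]_n,
    A `<=` \bigcup_k box (a k) (b k) /\
    v = (\sum_(0 <= k <oo) (box_volume (a k) (b k))%:E)%E].

End lebesgue.

Section path_integral.
Context {R : realType} {n : nat}.
Implicit Types (f : 'rV[R]_n -> 'rV[R]_n) (s : R -> 'rV[R]_n -> 'rV[R]_n).

Definition euclid_norm (x : 'rV[R]_n) : R := Num.sqrt (\sum_(i < n) x 0 i ^+ 2).

Definition is_flow f s : Prop :=
  [/\ forall x, s 0 x = x,
      forall t u x, s (t + u) x = s t (s u x)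
    & forall x (t : R), is_derive t (1 : R) (s ^~ x) (f (s t x))].

(* The transpose is needed because 'J f 0 acts on row vectors from the right,
   whereas A acts on column vectors from the left. *)
Definition linearization f : 'M[R]_n := ('J f 0)^T.

(* f(x) - A x *)
Definition nonlinear_part f (x : 'rV[R]_n) : 'rV[R]_n :=
  f x - (linearization f *m x^T)^T.

Definition complexify m p (A : 'M[R]_(m, p)) : 'M[R[i]]_(m, p) :=
  map_mx (real_complex R) A.

Definition hyperbolic_equilibrium f : Prop :=
  [/\ f 0 = 0, differentiable f 0
    & forall z : R[i],
        eigenvalue (complexify (linearization f)) z -> complex.Re z != 0].

(* w is the row vector w^T. *)
Definition left_eigenvector (A : 'M[R]_n) (lam : R[i]) (w : 'rV[R[i]]_n) : Prop :=
  w != 0 /\ w *m complexify A = lam *: w.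

Definition pairing (w : 'rV[R[i]]_n) (x : 'rV[R]_n) : R[i] :=
  (w *m complexify x^T) 0 0.

Definition cexp (z : R[i]) : R[i] :=
  (expR (complex.Re z))%:C%C * (cos (complex.Im z) +i* sin (complex.Im z))%C.

Definition cintegrable (D : set R) (g : R -> R[i]) : Prop :=
  lebesgue_measure.-integrable D (fun t => (complex.Re (g t))%:E) /\
  lebesgue_measure.-integrable D (fun t => (complex.Im (g t))%:E).

Definition cintegral (D : set R) (g : R -> R[i]) : R[i] :=
  ((\int[lebesgue_measure]_(t in D) complex.Re (g t))
   +i* (\int[lebesgue_measure]_(t in D) complex.Im (g t)))%C.

Definition path_integrand f s (lam : R[i]) (w : 'rV[R[i]]_n) (x : 'rV[R]_n)
    (tau : R) : R[i] :=
  cexp (- lam * tau%:C%C) * pairing w (nonlinear_part f (s tau x)).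

(* lam and w may be non-real; the equation then forces the right-hand side to
   be real, since phi is real-valued. *)
Definition is_path_integral f s (lam : R[i]) (w : 'rV[R[i]]_n)
    (t : 'rV[R]_n -> R) (X : set 'rV[R]_n) (phi : 'rV[R]_n -> R) : Prop :=
  forall x, X x ->
    cintegrable `[0, t x] (path_integrand f s lam w x) /\
    (phi x)%:C%C
      = pairing w x + cintegral `[0, t x] (path_integrand f s lam w x).

End path_integral.

Section regression.
Context {R : realType} {n N : nat}.
Implicit Types (mu : probability 'rV[R]_n R) (X : set 'rV[R]_n).
Implicit Types (psi : 'I_N -> 'rV[R]_n -> R) (phi : 'rV[R]_n -> R).

(* Functions on X are functions on R^n whose values outside X are ignored:
   phi \_ X is phi extended by 0. *)
Definition L2 mu X phi : Prop := phi \_ X \in Lfun mu 2%:E.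

Definition lincomb psi (c : 'cV[R]_N) (x : 'rV[R]_n) : R :=
  \sum_(j < N) c j 0 * psi j x.

Definition mu_independent mu X psi : Prop :=
  forall c : 'cV[R]_N, c != 0 -> mu (X `&` [set x | lincomb psi c x = 0]) = 0%E.

Definition sq_error mu X psi phi (c : 'cV[R]_N) : \bar R :=
  (\int[mu]_(x in X) ((lincomb psi c x - phi x) ^+ 2)%:E)%E.

(* argmin over the coefficient vectors; the default value 0 would be returned
   only if there were no minimizer. *)
Definition proj_coef mu X psi phi : 'cV[R]_N :=
  xget 0 [set c | forall d, (sq_error mu X psi phi c <= sq_error mu X psi phi d)%E].

Definition L2_proj mu X psi phi : 'rV[R]_n -> R :=
  lincomb psi (proj_coef mu X psi phi).

(* The four Penrose equations; over the reals the adjoint is the transpose. *)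
Definition is_pinv L (G : 'M[R]_(L, N)) (M : 'M[R]_(N, L)) : Prop :=
  [/\ G *m M *m G = G, M *m G *m M = M,
      (G *m M)^T = G *m M & (M *m G)^T = M *m G].

Definition pinv L (G : 'M[R]_(L, N)) : 'M[R]_(N, L) := xget 0 [set M | is_pinv G M].

(* y k is the sample x_{k+1}; the first L samples are y 0, ..., y (L-1). *)
Definition sample_mx psi (y : nat -> 'rV[R]_n) (L : nat) : 'M[R]_(L, N) :=
  \matrix_(i < L, j < N) psi j (y i).

Definition sample_values phi (y : nat -> 'rV[R]_n) (L : nat) : 'cV[R]_L :=
  \col_(i < L) phi (y i).

Definition ls_coef psi phi (y : nat -> 'rV[R]_n) (L : nat) : 'cV[R]_N :=
  pinv (sample_mx psi y L) *m sample_values phi y L.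

Definition ls_approx psi phi (y : nat -> 'rV[R]_n) (L : nat) : 'rV[R]_n -> R :=
  lincomb psi (ls_coef psi phi y L).

End regression.

Section sampling.
Context {R : realType} {d d' : measure_display}.
Context {Om : measurableType d} {T : measurableType d'}.
Variable P : probability Om R.

Definition mutually_independent (Y : nat -> {RV P >-> T}) : Prop :=
  forall (J : {fset nat}) (B : nat -> set T), (forall k, measurable (B k)) ->
    P (\bigcap_(k in [set` J]) (Y k @^-1` B k))
      = (\prod_(k <- J) P (Y k @^-1` B k))%E.

Definition iid_from (mu : probability T R) (Y : nat -> {RV P >-> T}) : Prop :=
  mutually_independent Y /\
  forall k (B : set T), measurable B -> distribution P (Y k) B = mu B.

End sampling.

(* Main.v *)
(* The least-squares coefficients solve the normal equations whose matrix and
   right-hand side are the empirical averages of psi_i psi_j and psi_i phi.  By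
   the strong law of large numbers these averages converge almost surely to the
   Gram matrix of psi in L2(mu) and to the vector of inner products with phi.
   mu-independence makes the Gram matrix invertible, so it is invertible for
   large L too, and the coefficients converge to the unique solution of the
   limiting normal equations, which are the coefficients of the projection.

   The strong law for integrable h >= 0 is proved by Etemadi's method along the
   subsequences m = a 2^j: truncating h at level m, Chebyshev's inequality and
   the union bound control the m-th average by the mean of min(h, m)^2 / m, and
   the sum of these over j is at most 4 h.  Borel-Cantelli then gives
   convergence along each subsequence; any n lies between a 2^j and (a+1) 2^j
   with a large, and monotonicity of the partial sums fills the gaps. *)
Require Import Defs.
From HB Require Import structures.
From mathcomp Require Import all_boot all_order all_algebra.
From mathcomp Require Import complex finmap.
From mathcomp Require Import all_classical all_reals all_analysis.
From mathcomp Require Import measurable_realfun ring lra.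
Set Implicit Arguments.
Unset Strict Implicit.
Unset Printing Implicit Defensive.
Import Order.TTheory GRing.Theory Num.Theory.
Import numFieldNormedType.Exports.

Local Open Scope classical_set_scope.
Local Open Scope ring_scope.

(** * Strong law of large numbers *)

Lemma truncation_series_le (R : realType) (h b : R) (J : nat) :
  0 <= h -> 0 < b ->
  \sum_(j < J) Num.min h (b * 2 ^+ j) ^+ 2 / (b * 2 ^+ j) <= 4 * h.
Proof.
move=> h0 b0.
(* The terms double up to the level h and halve beyond it; the bound has to
   be strengthened accordingly for the induction. *)
suff [H1 H2] :
  (h <= b ->
     \sum_(j < J) Num.min h (b * 2 ^+ j) ^+ 2 / (b * 2 ^+ j) <= 2 * h ^+ 2 / b) /\
  (b <= h ->
     \sum_(j < J) Num.min h (b * 2 ^+ j) ^+ 2 / (b * 2 ^+ j) <= 4 * h - b).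
  have [hb|/ltW bh] := leP h b.
    apply: (le_trans (H1 hb)); rewrite ler_pdivrMr//; nra.
  by apply: (le_trans (H2 bh)); lra.
elim: J b b0 => [|J IH] b b0.
  rewrite big_ord0; split=> H; last by lra.
  by rewrite divr_ge0 ?mulr_ge0 ?sqr_ge0 ?(ltW b0).
have -> : \sum_(j < J.+1) Num.min h (b * 2 ^+ j) ^+ 2 / (b * 2 ^+ j)
  = Num.min h b ^+ 2 / b + \sum_(j < J) Num.min h (b * 2 * 2 ^+ j) ^+ 2 / (b * 2 * 2 ^+ j).
  rewrite big_ord_recl expr0 mulr1; congr (_ + _).
  by apply: eq_bigr => j _; rewrite lift0 [2 ^+ j.+1]exprS mulrA.
have b20 : 0 < b * 2 by lra.
have [H1 H2] := IH _ b20; split=> hb.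
  rewrite min_l//; have := H1 (le_trans hb (ltac:(lra) : b <= b * 2)).
  rewrite (_ : 2 * h ^+ 2 / (b * 2) = h ^+ 2 / b); last by field; lra.
  by lra.
rewrite min_r// expr2 mulfK ?gt_eqF//.
have [hb2|/ltW b2h] := leP h (b * 2); last by have := H2 b2h; lra.
have := H1 hb2.
rewrite (_ : 2 * h ^+ 2 / (b * 2) = h ^+ 2 / b); last by field; lra.
suff : h ^+ 2 / b <= 4 * h - 2 * b by lra.
rewrite ler_pdivrMr//; nra.
Qed.

(** The exponent j is the largest with q 2^j <= n, and a is the quotient of n by 2^j. The multiplier
    a ranges over a finite set depending only on q, and the endpoints of the bracket have ratio at
    most 1 + 1/q. *)
Lemma dyadic_bracket (q n : nat) : (0 < q)%N -> (q <= n)%N ->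
  exists j a, [/\ (q <= a < q.*2)%N, (a * 2 ^ j <= n)%N & (n < a.+1 * 2 ^ j)%N].
Proof.
move=> q0 qn.
have [j [Hj1 Hj2]] : exists j, (q * 2 ^ j <= n)%N /\ (n < q * 2 ^ j.+1)%N.
  (* The least j with n < q 2^(j+1) is taken; minimality yields the lower bound, which at j = 0 is q
     <= n. *)
  have Pn : exists j, (n < q * 2 ^ j.+1)%N.
    exists n; apply: leq_trans (leq_pmull _ q0).
    exact: leq_trans (ltn_expl n (isT : (1 < 2)%N)) (leq_pexp2l _ (leqnSn n)).
  exists (ex_minn Pn); case: ex_minnP => -[|j] jn jmin; split=> //.
    by rewrite muln1.
  by rewrite leqNgt; apply/negP => /jmin; rewrite ltnn.
exists j, (n %/ 2 ^ j)%N; split.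
- rewrite leq_divRL ?expn_gt0// Hj1 ltn_divLR ?expn_gt0//=.
  by rewrite -muln2 -mulnA -expnS.
- exact: leq_divM.
- by rewrite ltn_ceil ?expn_gt0.
Qed.

(** * Integrals of functions of one or two samples *)

Section pairs.
Local Open Scope ereal_scope.

Lemma iid_joint_distribution (R : realType) (d d' : measure_display)
  (Om : measurableType d) (T : measurableType d') (P : probability Om R)
  (mu : probability T R) (Y : nat -> {RV P >-> T}) (iidY : iid_from mu Y)
  (i j : nat) (A B : set T) : i != j -> measurable A -> measurable B ->
  P ((fun om => (Y i om, Y j om)) @^-1` (A `*` B)) = mu A * mu B.
Proof.
move=> ij mA mB; case: iidY => indepY distrY.
(* Independence expects a measurable set at every index; only the values at i and j enter. *)
have := indepY [fset i; j]%fset (fun k => if k == i then A else B).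
rewrite (_ : \bigcap_(k in _) _ = (fun om => (Y i om, Y j om)) @^-1` (A `*` B)); last first.
  apply/seteqP; split=> om /=.
    move=> H; split=> /=.
      by have := H i; rewrite /= eqxx; apply; rewrite !inE eqxx.
    by have := H j; rewrite /= eq_sym (negbTE ij); apply; rewrite !inE eqxx orbT.
  move=> [/= HA HB] k /=; rewrite !inE => /orP[] /eqP ->; first by rewrite eqxx.
  by rewrite eq_sym (negbTE ij).
move=> ->; last by move=> k; case: ifP.
rewrite big_fsetU1 /=; last by rewrite inE.
rewrite big_seq_fset1 eqxx eq_sym (negbTE ij).
by rewrite -(distrY i _ mA) -(distrY j _ mB).
Qed.

Lemma iid_integral_comp (R : realType) (d d' : measure_display)
  (Om : measurableType d) (T : measurableType d') (P : probability Om R)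
  (mu : probability T R) (Y : nat -> {RV P >-> T}) (iidY : iid_from mu Y)
  (i : nat) (g : T -> \bar R) : measurable_fun setT g -> (forall x, 0 <= g x) ->
  \int[P]_om g (Y i om) = \int[mu]_x g x.
Proof.
move=> mg g0; transitivity (\int[distribution P (Y i)]_x g x).
  by rewrite ge0_integral_pushforward.
by apply: eq_measure_integral => A mA _; case: iidY => _; apply.
Qed.

(** The law of the pair agrees with the product measure on rectangles, hence everywhere by
    uniqueness of the product measure; Tonelli then factors the integral. *)
Lemma iid_integral_mul (R : realType) (d d' : measure_display)
  (Om : measurableType d) (T : measurableType d') (P : probability Om R)
  (mu : probability T R) (Y : nat -> {RV P >-> T}) (iidY : iid_from mu Y)
  (i j : nat) (g : T -> \bar R) : i != j ->
  measurable_fun setT g -> (forall x, 0 <= g x) ->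
  \int[P]_om (g (Y i om) * g (Y j om)) = (\int[mu]_x g x) * (\int[mu]_x g x).
Proof.
move=> ij mg g0.
pose Z om := (Y i om, Y j om).
have mZ : measurable_fun setT Z by exact/measurable_fun_pair.
pose G (z : T * T) := g z.1 * g z.2.
have mG : measurable_fun setT G.
  by apply: emeasurable_funM; apply: measurableT_comp.
have G0 z : 0 <= G z by rewrite mule_ge0.
transitivity (\int[pushforward P Z]_z G z).
  by rewrite ge0_integral_pushforward.
transitivity (\int[mu \x mu]_z G z).
  apply: eq_measure_integral => A mA _; apply/esym.
  apply: (@product_measure_unique _ _ _ _ _ mu mu (pushforward P Z)) => // B C mB mC.
  exact: (iid_joint_distribution iidY).
rewrite fubini_tonelli1//.
under eq_integral => x _.
  rewrite /fubini_F /G /= ge0_integralZl//.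
  over.
by rewrite ge0_integralZr// integral_ge0.
Qed.

End pairs.

(** * Markov's inequality and the variance of a sum *)

Section deviations.
Local Open Scope ereal_scope.

Lemma measure_le_integral (R : realType) (d : measure_display)
  (T : measurableType d) (mu : {measure set T -> \bar R}) (f : T -> \bar R)
  (A : set T) (c : R) : measurable A -> measurable_fun setT f ->
  (forall x, 0 <= f x) -> (forall x, A x -> c%:E <= f x) -> (0 <= c)%R ->
  c%:E * mu A <= \int[mu]_x f x.
Proof.
move=> mA mf f0 cf c0; rewrite -integral_cst//.
apply: (@le_trans _ _ (\int[mu]_(x in A) f x)).
  by apply: ge0_le_integral => //; exact: measurable_funTS.
exact: ge0_subset_integral.
Qed.

(** The variance of a sum of m uncorrelated terms is at most m times the second moment of one. The
    second moment of [g] may be infinite. *)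
Lemma iid_sum_sqr_dev (R : realType) (d d' : measure_display)
  (Om : measurableType d) (T : measurableType d') (P : probability Om R)
  (mu : probability T R) (Y : nat -> {RV P >-> T}) (iidY : iid_from mu Y)
  (g : T -> R) (I : R) (m : nat) : measurable_fun setT g ->
  (forall x, 0 <= g x)%R -> \int[mu]_x (g x)%:E = I%:E ->
  \int[P]_om ((\sum_(i < m) g (Y i om) - m%:R * I) ^+ 2)%:E
    <= m%:R%:E * \int[mu]_x (g x ^+ 2)%:E.
Proof.
move=> mg g0 Ig; set Q := \int[mu]_x (g x ^+ 2)%:E; set c := (m%:R * I)%R.
pose S om := (\sum_(i < m) g (Y i om))%R.
have mgY i : measurable_fun setT (g \o Y i) by exact: measurableT_comp.
have mS : measurable_fun setT S by apply: measurable_sum => i; exact: mgY.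
have S0 om : (0 <= S om)%R by rewrite /S sumr_ge0.
have mEg : measurable_fun setT (fun x => (g x)%:E) by exact/measurable_EFinP.
have Eg0 x : 0 <= (g x)%:E by rewrite lee_fin.
have I0 : (0 <= I)%R by rewrite -lee_fin -Ig integral_ge0// => x _; rewrite lee_fin.
have c0 : (0 <= c)%R by rewrite /c mulr_ge0.
have Q0 : 0 <= Q by apply: integral_ge0 => x _; rewrite lee_fin sqr_ge0.
have ES : \int[P]_om (S om)%:E = c%:E.
  under eq_integral do rewrite /S -sumEFin.
  rewrite ge0_integral_sum//; last first.
    by move=> i; apply/measurable_EFinP; exact: mgY.
  under eq_bigr => i _.
    rewrite (iid_integral_comp iidY i mEg Eg0) Ig.
    over.
  by rewrite sumEFin sumr_const card_ord /c mulr_natl.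
have ES2 : \int[P]_om (S om ^+ 2)%:E <= m%:R%:E * Q + (c ^+ 2)%:E.
  have -> : \int[P]_om (S om ^+ 2)%:E
      = \sum_(i < m) \sum_(j < m) \int[P]_om ((g (Y i om))%:E * (g (Y j om))%:E).
    under eq_integral => om _.
      rewrite expr2 /S big_distrlr /= -sumEFin.
      under eq_bigr do rewrite -sumEFin.
      over.
    have mgg (i j : 'I_m) : measurable_fun setT (fun om => (g (Y i om) * g (Y j om))%:E).
      by apply/measurable_EFinP; exact: measurable_funM (mgY i) (mgY j).
    rewrite ge0_integral_sum//; last 2 first.
    - by move=> i; apply: emeasurable_sum => j; exact: mgg.
    - by move=> i om _; apply: sume_ge0 => j _; rewrite lee_fin mulr_ge0.
    apply: eq_bigr => i _; rewrite ge0_integral_sum//.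
    by move=> j om _; rewrite lee_fin mulr_ge0.
  have H (i j : 'I_m) : \int[P]_om ((g (Y i om))%:E * (g (Y j om))%:E)
      <= (if i == j then Q else 0) + (I ^+ 2)%:E.
    case: eqVneq => [<-|ij].
      under eq_integral do rewrite -EFinM -expr2.
      rewrite (iid_integral_comp iidY i (g := fun x => (g x ^+ 2)%:E)); last 2 first.
      - by apply/measurable_EFinP; exact: measurable_funX.
      - by move=> x; rewrite lee_fin sqr_ge0.
      by rewrite leeDl// lee_fin sqr_ge0.
    rewrite (iid_integral_mul iidY ij mEg Eg0).
    by rewrite /= Ig -EFinM add0e -expr2.
  apply: (le_trans (lee_sum _ (fun i _ => lee_sum _ (fun j _ => H i j)))).
  under eq_bigr do rewrite big_split /= -big_mkcond
    (big_pred1 _ (fun=> eq_sym _ _)) sumEFin sumr_const card_ord.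
  rewrite big_split /= sumEFin !sumr_const card_ord.
  apply: leeD; last by rewrite lee_fin /c exprMn -mulrnA mulnn -natrX mulr_natl.
  by rewrite mule_natl.
(* Adding 2 c S to (S - c)^2 keeps every integrand nonnegative. *)
have : \int[P]_om ((S om - c) ^+ 2)%:E + (2 * c * c)%:E
    <= m%:R%:E * Q + (2 * c * c)%:E.
  apply: (@le_trans _ _ (\int[P]_om (S om ^+ 2)%:E + (c ^+ 2)%:E)); last first.
    rewrite (_ : 2 * c * c = c ^+ 2 + c ^+ 2)%R; last by ring.
    by rewrite EFinD addeA leeD2r.
  rewrite (EFinM (2 * c)) -ES -ge0_integralZl_EFin//; last 3 first.
  - by move=> om _; rewrite lee_fin.
  - exact/measurable_EFinP.
  - by rewrite mulr_ge0.
  have <- : \int[P]_om (cst (c ^+ 2)%:E om) = (c ^+ 2)%:E.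
    by rewrite integral_cst//= probability_setT mule1.
  rewrite -!ge0_integralD//=; first last.
  - by apply/measurable_EFinP; apply: measurable_funM.
  - by move=> om _; rewrite -EFinM lee_fin !mulr_ge0.
  - by apply/measurable_EFinP; apply: measurable_funX; exact: measurable_funB.
  - by move=> om _; rewrite lee_fin sqr_ge0.
  - by move=> om _; rewrite lee_fin sqr_ge0.
  - by apply/measurable_EFinP; exact: measurable_funX.
  - by move=> om _; rewrite lee_fin sqr_ge0.
  rewrite le_eqVlt; apply/orP; left; apply/eqP; apply: eq_integral => om _.
  by rewrite -EFinM -!EFinD; congr EFin; ring.
by rewrite leeD2rE.
Qed.

End deviations.

(** * Tail bound for one average *)

Section truncation.
Local Open Scope ereal_scope.

(** A deviation of the sum of h forces either a deviation of the sum truncated at m or a sample at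
    which h reaches m. One integral [K] bounds both: Chebyshev gives eps^-2 K for the former, the
    union bound gives K for the latter. *)
Lemma iid_truncated_tail (R : realType) (d d' : measure_display)
  (Om : measurableType d) (T : measurableType d') (P : probability Om R)
  (mu : probability T R) (Y : nat -> {RV P >-> T}) (iidY : iid_from mu Y)
  (h : T -> R) (I eps : R) (m : nat) : measurable_fun setT h ->
  (forall x, 0 <= h x)%R -> (0 < eps)%R -> (0 < m)%N ->
  \int[mu]_x (Num.min (h x) m%:R)%:E = I%:E ->
  P [set om | (eps * m%:R <= `|\sum_(i < m) h (Y i om) - m%:R * I|)%R]
    <= (1 + eps ^- 2)%:E * \int[mu]_x (Num.min (h x) m%:R ^+ 2 / m%:R)%:E.
Proof.
move=> mh h0 eps0 m0 Ig.
set b : R := m%:R; have b0 : (0 < b)%R by rewrite ltr0n.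
pose g x := Num.min (h x) b.
set K := \int[mu]_x _.
have mg : measurable_fun setT g by exact: measurable_minr.
have g0 x : (0 <= g x)%R by rewrite le_min h0 ltW.
have mg2 : measurable_fun setT (fun x => (g x ^+ 2 / b)%:E).
  by apply/measurable_EFinP; apply: measurable_funM => //; exact: measurable_funX.
have g20 x : 0 <= (g x ^+ 2 / b)%:E by rewrite lee_fin divr_ge0 ?sqr_ge0// ltW.
have mS (k : T -> R) : measurable_fun setT k ->
    measurable_fun setT (fun om => \sum_(i < m) k (Y i om) - b * I)%R.
  move=> mk; apply: measurable_funB => //; apply: measurable_sum => i.
  exact: measurableT_comp.
have mE (k : T -> R) : measurable_fun setT k ->
    measurable [set om | (eps * b <= `|\sum_(i < m) k (Y i om) - b * I|)%R].
  move=> mk; rewrite -[X in measurable X]setTI.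
  by apply: measurable_fun_le => //; apply: measurableT_comp => //; exact: mS.
have mB : measurable [set x | (b <= h x)%R].
  by rewrite -[X in measurable X]setTI; exact: measurable_fun_le.
pose E1 := [set om | (eps * b <= `|\sum_(i < m) g (Y i om) - b * I|)%R].
pose E2 i := Y i @^-1` [set x | (b <= h x)%R].
have mE2 i : measurable (E2 i).
  by rewrite -[X in measurable X]setTI; exact: (measurable_funPT (Y i)).
(* Where no sample reaches the level b, truncation changes nothing and the two sums coincide. *)
have sub : [set om | (eps * b <= `|\sum_(i < m) h (Y i om) - b * I|)%R]
    `<=` E1 `|` \big[setU/set0]_(i < m) E2 i.
  move=> om /= Hom; have [|nE2] := pselect ((\big[setU/set0]_(i < m) E2 i) om).
    by right.
  left; rewrite /E1 /= (eq_bigr (fun i : 'I_m => h (Y i om)))// => i _.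
  rewrite /g min_l// leNgt; apply/negP => /ltW bh; apply: nE2.
  by rewrite -(bigcup_mkord m E2); exists (val i) => /=.
apply: (le_trans (le_measure _ _ _ sub)); rewrite ?inE; first exact: mE.
  by apply: measurableU; [exact: mE|exact: bigsetU_measurable].
apply: (le_trans (measureU2 _ _ _)); [exact: mE|exact: bigsetU_measurable|].
rewrite EFinD ge0_muleDl// ?lee_fin ?invr_ge0 ?sqr_ge0// mul1e addeC.
apply: leeD.
  apply: (le_trans (Boole_inequality P (fun i _ => mE2 i))).
  apply: (@le_trans _ _ (b%:E * mu [set x | (b <= h x)%R])).
    rewrite (eq_bigr (fun=> mu [set x | (b <= h x)%R])).
      by rewrite sumr_const card_ord /b mule_natl.
    by move=> i _; case: iidY => _ /(_ i _ mB) <-.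
  (* On the set where h >= b, the integrand min(h, b)^2 / b equals b. *)
  apply: measure_le_integral => // x /= bh.
  by rewrite /g min_r// lee_fin expr2 mulfK// gt_eqF.
have : ((eps * b) ^+ 2)%:E * P E1 <= m%:R%:E * \int[mu]_x (g x ^+ 2)%:E.
  apply: le_trans (iid_sum_sqr_dev iidY m mg g0 Ig).
  apply: measure_le_integral => //.
  - exact: mE.
  - by apply/measurable_EFinP; apply: measurable_funX; exact: mS.
  - by move=> om; rewrite lee_fin sqr_ge0.
  - move=> om /= Eom; rewrite lee_fin -[leRHS]real_normK ?num_real//.
    by rewrite lerXn2r// ?nnegrE// mulr_ge0// ltW.
  - exact: sqr_ge0.
(* Since b = m, the variance bound is b^2 K, and the b^2 of the Chebyshev factor (eps b)^2
   cancels. *)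
have -> : m%:R%:E * \int[mu]_x (g x ^+ 2)%:E = (b ^+ 2)%:E * K.
  have -> : \int[mu]_x (g x ^+ 2)%:E = b%:E * K.
    rewrite -ge0_integralZl_EFin//; last by move=> x _; exact: g20.
    by apply: eq_integral => x _; rewrite -EFinM mulrC divfK// gt_eqF.
  by rewrite muleA -EFinM -expr2.
rewrite exprMn mulrC EFinM -muleA lee_pmul2l//; last by rewrite lte_fin exprn_gt0.
by rewrite lee_pdivlMl// exprn_gt0.
Qed.

End truncation.

(** * Almost sure convergence along dyadic subsequences *)

Section dyadic.
Local Open Scope ereal_scope.

Lemma truncated_mean_cvg (R : realType) (d : measure_display)
  (T : measurableType d) (mu : {measure set T -> \bar R}) (h : T -> R)
  (b : R^nat) : measurable_fun setT h -> (forall x, 0 <= h x)%R ->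
  (forall n, 0 <= b n)%R -> nondecreasing_seq b -> b @ \oo --> +oo%R ->
  \int[mu]_x (Num.min (h x) (b n))%:E @[n --> \oo] --> \int[mu]_x (h x)%:E.
Proof.
move=> mh h0 b0 ndb boo.
have lim_min x : (limn (fun n => (Num.min (h x) (b n))%:E)) = (h x)%:E.
  apply/cvg_lim => //; apply/cvg_EFin; first by apply: nearW.
  apply: cvg_near_cst; move/cvgryPge: boo => /(_ (h x)).
  by apply: filterS => n hb; rewrite /= min_l.
rewrite [X in _ --> X](_ : _ =
    \int[mu]_x limn (fun n => (Num.min (h x) (b n))%:E)); last first.
  by apply: eq_integral => x _; rewrite lim_min.
apply: cvg_monotone_convergence => //.
- by move=> n; apply/measurable_EFinP; exact: measurable_minr.
- by move=> n x _; rewrite lee_fin le_min h0 b0.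
- by move=> x _ m n mn; rewrite lee_fin le_min ge_min lexx /= ge_min ndb ?orbT.
Qed.

(** Deviations are measured from the truncated means [J j], for which the tail probabilities are
    summable; the [J j] themselves tend to I by monotone convergence. *)
Lemma iid_dyadic_slln (R : realType) (d d' : measure_display)
  (Om : measurableType d) (T : measurableType d') (P : probability Om R)
  (mu : probability T R) (Y : nat -> {RV P >-> T}) (iidY : iid_from mu Y)
  (h : T -> R) (I : R) (a : nat) : measurable_fun setT h ->
  (forall x, 0 <= h x)%R -> \int[mu]_x (h x)%:E = I%:E -> (0 < a)%N ->
  {ae P, forall om, ((\sum_(i < a * 2 ^ j) h (Y i om)) / (a * 2 ^ j)%:R
                       @[j --> \oo] --> I)%R}.
Proof.
move=> mh h0 hI a0.
pose m j := (a * 2 ^ j)%N.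
have m0 j : (0 < m j)%N by rewrite muln_gt0 a0 expn_gt0.
pose b j : R := (m j)%:R.
have b0 j : (0 < b j)%R by rewrite ltr0n.
pose J j := \int[mu]_x (Num.min (h x) (b j))%:E.
have mh' j : measurable_fun setT (fun x => Num.min (h x) (b j)).
  exact: measurable_minr.
have Jfin j : J j \is a fin_num.
  rewrite ge0_fin_numE; last first.
    by apply: integral_ge0 => x _; rewrite lee_fin le_min h0 ltW.
  apply: (@le_lt_trans _ _ I%:E); last exact: ltry.
  rewrite -hI; apply: ge0_le_integral => //.
  - by move=> x _; rewrite lee_fin le_min h0 ltW.
  - exact/measurable_EFinP.
  - exact/measurable_EFinP.
  - by move=> x _; rewrite lee_fin ge_min lexx.
have JI : (fine (J j) @[j --> \oo] --> I)%R.
  apply: fine_cvg; rewrite -hI; apply: truncated_mean_cvg => //.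
  - by move=> p q pq; rewrite /b ler_nat /m leq_pmul2l// leq_pexp2l.
  - apply/cvgryPge => A; near=> n; apply: (@le_trans _ _ n%:R).
      by near: n; exact: nbhs_infty_ger.
    rewrite ler_nat /m (leq_trans (ltnW (ltn_expl n (isT : (1 < 2)%N))))//.
    exact: leq_pmull.
(* The tolerances 1/(k+1) are countably many, so the exceptional sets combine into one null set. *)
pose F (k j : nat) := [set om | ((k.+1%:R)^-1 * (m j)%:R <=
    `|\sum_(i < m j) h (Y i om) - (m j)%:R * fine (J j)|)%R].
have mF k j : measurable (F k j).
  rewrite -[X in measurable X]setTI; apply: measurable_fun_le => //.
  apply: measurableT_comp => //; apply: measurable_funB => //.
  by apply: measurable_sum => i; exact: measurableT_comp.
have F0 k : P (lim_sup_set (F k)) = 0.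
  apply: lim_sup_set_cvg0 => //.
  (* This is the constant of [iid_truncated_tail] at eps = 1/(k+1). Summing under the integral and
     using [truncation_series_le] pointwise bounds the series by C * 4 I. *)
  pose C : R := (1 + ((k.+1%:R)^-1) ^- 2)%R.
  have C0 : (0 <= C)%R by rewrite addr_ge0// invr_ge0 sqr_ge0.
  apply: (@le_lt_trans _ _ (C%:E * (4 * I)%:E)); last by rewrite -EFinM ltry.
  apply: lime_le; first exact: is_cvg_nneseries.
  apply: nearW => n; rewrite big_mkord.
  apply: (@le_trans _ _ (\sum_(j < n)
      C%:E * \int[mu]_x (Num.min (h x) (b j) ^+ 2 / b j)%:E)).
    apply: lee_sum => j _; apply: (iid_truncated_tail iidY) => //.
    by rewrite fineK.
  have mq j : measurable_fun setT (fun x => (Num.min (h x) (b j) ^+ 2 / b j)%:E).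
    by apply/measurable_EFinP; apply: measurable_funM => //; exact: measurable_funX.
  have q0 j x : 0 <= (Num.min (h x) (b j) ^+ 2 / b j)%:E.
    by rewrite lee_fin divr_ge0 ?sqr_ge0// ltW.
  rewrite -ge0_sume_distrr; last by move=> j _; exact: integral_ge0.
  rewrite lee_wpmul2l ?lee_fin//.
  rewrite -ge0_integral_sum// EFinM -hI -ge0_integralZl_EFin//; last 2 first.
  - by move=> x _; rewrite lee_fin.
  - exact/measurable_EFinP.
  apply: ge0_le_integral => //.
  - by move=> x _; exact: sume_ge0.
  - exact: emeasurable_sum.
  - by apply/measurable_EFinP; exact: measurable_funM.
  - move=> x _; rewrite sumEFin -EFinM lee_fin.
    rewrite (eq_bigr (fun j : 'I_n =>
      Num.min (h x) (a%:R * 2 ^+ j) ^+ 2 / (a%:R * 2 ^+ j)))%R.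
      by apply: truncation_series_le; rewrite ?ltr0n.
    by move=> j _; rewrite /b /m natrM natrX.
have aeF : {ae P, forall om, forall k, ~ lim_sup_set (F k) om}.
  apply: ae_foralln => k; exists (lim_sup_set (F k)); split.
  - apply: bigcapT_measurable => n.
    by apply: bigcup_measurable => j _; exact: mF.
  - exact: F0.
  - by move=> om /= /contrapT.
apply: filterS aeF => om Hom.
rewrite (_ : (fun j => _) =
  (fun j => ((\sum_(i < m j) h (Y i om)) / b j - fine (J j)) + fine (J j))%R); last first.
  by apply/funext => j; rewrite subrK.
rewrite -[X in _ --> X]add0r; apply: cvgD => //.
apply/cvgr0Pnorm_lt => e e0.
have [k ke] : exists k, (k.+1%:R^-1 < e)%R.
  have /cvgr0Pnorm_lt/(_ e e0) [k _ /(_ k (leqnn k))] := @cvg_harmonic R.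
  by rewrite /= ger0_norm ?invr_ge0// => ?; exists k.
(* Outside the limit superior, [F k j] fails for all j from some n on. *)
have := Hom k; rewrite /lim_sup_set => /existsNP[n /not_implyP[_ nF]].
exists n => // j /= nj.
have {nF} /negP : ~ F k j om by move=> Fj; apply: nF; exists j.
rewrite -ltNge => Fj; apply: (le_lt_trans _ ke).
rewrite (_ : (_ - _)%R = ((\sum_(i < m j) h (Y i om) - b j * fine (J j)) / b j)%R); last first.
  by rewrite mulrBl [(b j * fine _)%R]mulrC mulfK// gt_eqF.
rewrite normrM (@gtr0_norm _ (b j)^-1) ?invr_gt0// ler_pdivrMr//.
exact: ltW.
Unshelve. all: by end_near. Qed.

End dyadic.

(** For n between a 2^j and (a+1) 2^j, monotonicity traps S n between the values at the endpoints.
    Replacing an endpoint by n in the denominator costs a factor at most 1 + 1/a, close to 1 when a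
    >= q is large. *)
Lemma dyadic_average_cvg (R : realType) (S : nat -> R) (l : R) :
  (forall n, 0 <= S n) -> nondecreasing_seq S ->
  (forall a, (0 < a)%N -> S (a * 2 ^ j)%N / (a * 2 ^ j)%:R @[j --> \oo] --> l) ->
  S n / n%:R @[n --> \oo] --> l.
Proof.
move=> S0 ndS Sl.
have l0 : 0 <= l.
  have Sl1 := Sl 1%N isT; rewrite -(cvg_lim (@Rhausdorff R) Sl1).
  apply: limr_ge; first by apply/cvg_ex; exists l.
  by apply: nearW => j; rewrite divr_ge0.
apply/cvgrPdist_le => e e0.
pose del := e / 2; have del0 : 0 < del by rewrite divr_gt0.
(* With this q, passing from a to a+1 costs at most [del], the other half of e. *)
have [q q0 lq] : exists2 q, (0 < q)%N & l + del <= del * q%:R.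
  exists (Num.truncn ((l + del) / del)).+1 => //.
  by rewrite mulrC -ler_pdivrMr// ltW// truncnS_gt.
(* Only finitely many multipliers occur, so one threshold J serves them all. The value 2q is
   included because a+1 can reach it. *)
have : \forall j \near \oo, forall a : 'I_(q.*2).+1, (q <= a)%N ->
    `|l - S (a * 2 ^ j)%N / (a * 2 ^ j)%:R| <= del.
  apply: filter_forall => a; have [qa|aq] := leqP q a; last first.
    by apply: nearW.
  have := Sl a (leq_trans q0 qa) => /cvgrPdist_le/(_ del del0).
  by apply: filterS.
move=> [J _ HJ].
(* Since n < (a+1) 2^j <= 2q 2^j, this threshold forces j > J. *)
exists (q.*2 * 2 ^ J)%N => // n /= Jn.
have qn : (q <= n)%N.
  apply: leq_trans Jn; rewrite -addnn mulnDl.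
  by apply: leq_trans (leq_addl _ _); rewrite leq_pmulr// expn_gt0.
have [j [a [/andP[qa a2q] aj ja]]] := dyadic_bracket q0 qn.
have Jj : (J <= j)%N.
  have := leq_ltn_trans Jn (leq_trans ja (leq_mul a2q (leqnn (2 ^ j)))).
  by rewrite ltn_pmul2l ?double_gt0// ltn_exp2l// => /ltnW.
have Da0 : 0 < a%:R :> R by rewrite ltr0n (leq_trans q0).
have D0 : 0 < (2 ^ j)%:R :> R by rewrite ltr0n expn_gt0.
have bnd (c : nat) : (q <= c)%N -> (c <= q.*2)%N ->
    (l - del) * (c%:R * (2 ^ j)%:R) <= S (c * 2 ^ j)%N <= (l + del) * (c%:R * (2 ^ j)%:R).
  move=> qc c2q; have := HJ j Jj (Ordinal (c2q : (c < (q.*2).+1)%N)) qc.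
  have c0 : 0 < (c * 2 ^ j)%:R :> R by rewrite ltr0n muln_gt0 (leq_trans q0 qc) expn_gt0.
  rewrite /= distrC ler_distl -natrM ler_pdivrMr// ler_pdivlMr//.
have /andP[lo _] := bnd a qa (ltnW a2q).
have /andP[_ up] := bnd a.+1 (leqW qa) a2q.
have Sn_lo := ndS _ _ aj; have Sn_up := ndS _ _ (ltnW ja).
have naj : a%:R * (2 ^ j)%:R <= n%:R :> R by rewrite -natrM ler_nat.
have nja : n%:R <= a%:R * (2 ^ j)%:R + (2 ^ j)%:R :> R.
  by rewrite -natrM -natrD ler_nat addnC -mulSn ltnW.
have n0 : 0 < n%:R :> R by rewrite ltr0n (leq_trans q0).
have la : l + del <= del * a%:R.
  by apply: (le_trans lq); rewrite ler_pM2l// ler_nat.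
rewrite -natr1 in up.
have e2 : e = 2 * del by rewrite /del; field.
have Sn0 := S0 n.
clearbody del; move: naj nja up lo Sn_lo Sn_up.
set D := (2 ^ j)%:R in D0 *; set A := a%:R in Da0 la *; set x := n%:R in n0 *.
move=> naj nja up lo Sn_lo Sn_up.
have lD : (l + del) * D <= del * A * D by rewrite ler_pM2r.
rewrite distrC ler_distl ler_pdivlMr// ler_pdivrMr// e2; apply/andP; split.
  (* The bound on n may be multiplied by l - 2 del only if that factor is positive; otherwise S n >=
     0 suffices. *)
  have [neg|pos] := leP (l - 2 * del) 0.
    by apply: le_trans Sn0; rewrite mulr_le0_ge0// ltW.
  apply: le_trans Sn_lo; apply: le_trans lo; nra.
apply: (le_trans Sn_up); apply: (le_trans up); nra.
Qed.

Lemma iid_slln_ge0 (R : realType) (d d' : measure_display)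
  (Om : measurableType d) (T : measurableType d') (P : probability Om R)
  (mu : probability T R) (Y : nat -> {RV P >-> T}) (iidY : iid_from mu Y)
  (h : T -> R) : mu.-integrable setT (EFin \o h) -> (forall x, 0 <= h x) ->
  {ae P, forall om, (\sum_(i < n) h (Y i om)) / n%:R @[n --> \oo]
                      --> \int[mu]_x h x}.
Proof.
move=> ih h0.
have mh : measurable_fun setT h by apply/measurable_EFinP; exact: measurable_int ih.
have hI : (\int[mu]_x (h x)%:E = (\int[mu]_x h x)%:E)%E.
  by rewrite /Rintegral fineK//; exact: integrable_fin_num.
have : {ae P, forall om, forall a,
    (\sum_(i < a.+1 * 2 ^ j) h (Y i om)) / (a.+1 * 2 ^ j)%:R
       @[j --> \oo] --> \int[mu]_x h x}.
  by apply: ae_foralln => a; have := iid_dyadic_slln iidY mh h0 hI (isT : 0 < a.+1)%N.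
apply: filterS => om Hom.
apply: (@dyadic_average_cvg _ (fun n => \sum_(i < n) h (Y i om))).
- by move=> n; apply: sumr_ge0.
- apply/nondecreasing_seqP => n; rewrite big_ord_recr /= lerDl//.
- by case.
Qed.

(** The function h is the difference of |h| + h and |h|, both nonnegative and integrable. *)
Lemma iid_slln (R : realType) (d d' : measure_display)
  (Om : measurableType d) (T : measurableType d') (P : probability Om R)
  (mu : probability T R) (Y : nat -> {RV P >-> T}) (iidY : iid_from mu Y)
  (h : T -> R) : mu.-integrable setT (EFin \o h) ->
  {ae P, forall om, (\sum_(i < n) h (Y i om)) / n%:R @[n --> \oo]
                      --> \int[mu]_x h x}.
Proof.
move=> ih.
have ia : mu.-integrable setT (EFin \o (fun x => `|h x|)) by exact: integrable_norm ih.
have ip : mu.-integrable setT (EFin \o (fun x => `|h x| + h x)).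
  exact: integrableD ia ih.
have p0 x : 0 <= `|h x| + h x by rewrite -lerBlDr sub0r -normrN ler_norm.
have hs := iid_slln_ge0 iidY ip p0.
have ha := iid_slln_ge0 iidY ia (fun x => normr_ge0 _).
apply: filterS2 hs ha => om hs ha.
have -> : \int[mu]_x h x = \int[mu]_x (`|h x| + h x) - \int[mu]_x `|h x|.
  by rewrite RintegralD// addrAC subrr add0r.
apply: cvg_trans (cvgB hs ha); apply: near_eq_cvg; apply: nearW => n /=.
rewrite [LHS](_ : _ = (\sum_(i < n) (`|h (Y i om)| + h (Y i om))) / n%:R -
  (\sum_(i < n) `|h (Y i om)|) / n%:R)//.
by rewrite -mulrBl -sumrB; congr (_ / _); apply: eq_bigr => i _; rewrite addrAC subrr add0r.
Qed.

(** * Normal equations *)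

(** The formula satisfies the Penrose equations. Conversely, any M satisfying them has G^T G M = G^T
    (G M)^T = (G M G)^T = G^T, which determines M. *)
Lemma pinv_full_col_rank (R : realType) (L N : nat) (G : 'M[R]_(L, N)) :
  G^T *m G \in unitmx -> Defs.pinv G = invmx (G^T *m G) *m G^T.
Proof.
move=> uG; apply: xget_unique => /=.
  split; rewrite ?mulmxA.
  - by rewrite -(mulmxA _ G^T G) -(mulmxA G) mulVmx// mulmx1.
  - by rewrite -(mulmxA _ G^T G) mulVmx// mul1mx.
  - by rewrite !trmx_mul trmxK trmx_inv trmx_mul trmxK mulmxA.
  - by rewrite -mulmxA mulVmx// trmx1.
move=> M [GMG _ GMs _].
have : G^T *m G *m M = G^T.
  by rewrite -mulmxA -[X in _ *m X]GMs -trmx_mul GMG.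
by move=> E; rewrite -{2}E mulmxA mulVmx// mul1mx.
Qed.

(** * Entrywise limits of matrices, determinants and inverses *)

Section matrix_limits.
Context {R : realType}.

Lemma cvg_mx_entries (m n : nat) (A : nat -> 'M[R]_(m, n)) (B : 'M[R]_(m, n)) :
  (forall i j, A k i j @[k --> \oo] --> B i j) -> A @ \oo --> B.
Proof.
move=> AB; apply/cvg_mx_entourageP => E entE.
apply: filter_forall => i; apply: filter_forall => j.
have /cvg_entourageP/(_ _ entE) H := AB i j.
by near=> k; apply: mem_set; near: k; exact: H.
Unshelve. all: by end_near.
Qed.

Lemma cvg_det (n : nat) (A : nat -> 'M[R]_n) (B : 'M[R]_n) :
  (forall i j, A k i j @[k --> \oo] --> B i j) -> \det (A k) @[k --> \oo] --> \det B.
Proof.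
move=> AB; rewrite /determinant.
apply: cvg_big => [|s _]; first exact: add_continuous.
apply: cvgM; first exact: cvg_cst.
by apply: cvg_big => [|i _]; [exact: mul_continuous|exact: AB].
Qed.

(** The inverse is the adjugate divided by the determinant; both are polynomial in the entries, and
    the limit determinant is nonzero. *)
Lemma cvg_invmx_mul (n : nat) (A : nat -> 'M[R]_n) (B : 'M[R]_n)
  (u : nat -> 'cV[R]_n) (v : 'cV[R]_n) : B \in unitmx ->
  (forall i j, A k i j @[k --> \oo] --> B i j) ->
  (forall i, u k i 0 @[k --> \oo] --> v i 0) ->
  (\forall k \near \oo, A k \in unitmx) /\
  forall i, (invmx (A k) *m u k) i 0 @[k --> \oo] --> (invmx B *m v) i 0.
Proof.
move=> uB AB uv; have dAB := cvg_det AB.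
have dB0 : \det B != 0 by rewrite -unitfE -unitmxE.
have nuA : \forall k \near \oo, A k \in unitmx.
  near=> k; rewrite unitmxE unitfE; near: k.
  exact: cvgr_neq0 dAB dB0.
split=> // i.
have cvg_adj j : (\adj (A k)) i j @[k --> \oo] --> (\adj B) i j.
  under eq_fun do rewrite mxE /cofactor.
  rewrite mxE /cofactor; apply: cvgM; first exact: cvg_cst.
  apply: cvg_det => p q; under eq_fun do rewrite !mxE.
  by rewrite !mxE; exact: AB.
have : (\det (A k))^-1 * (\sum_j (\adj (A k)) i j * u k j 0) @[k --> \oo]
    --> (\det B)^-1 * (\sum_j (\adj B) i j * v j 0).
  apply: cvgM; first exact: cvgV.
  apply: cvg_big => [|j _]; first exact: add_continuous.
  exact: cvgM.
(* On a singular matrix [invmx] is the identity map, so the formula holds only for k large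
   enough. *)
have invE (M : 'M[R]_n) (w : 'cV[R]_n) : M \in unitmx ->
    (\det M)^-1 * (\sum_j (\adj M) i j * w j 0) = (invmx M *m w) i 0.
  by move=> uM; rewrite /invmx uM -scalemxAl !mxE.
rewrite invE//; apply: cvg_trans; apply: near_eq_cvg.
by apply: filterS nuA => k /(invE _ (u k)).
Unshelve. all: by end_near.
Qed.

End matrix_limits.

(** * Projection in L2 *)

Section l2_projection.
Context {R : realType} {d : measure_display} {T : measurableType d}.
Context (mu : probability T R) {N : nat} (p : 'I_N -> T -> R) (q : T -> R).
Hypothesis pL2 : forall j, p j \in Lfun mu 2%:E.
Hypothesis qL2 : q \in Lfun mu 2%:E.

Let lin (c : 'cV[R]_N) (x : T) := \sum_j c j 0 * p j x.

Definition gram : 'M[R]_N := \matrix_(i, j) \int[mu]_x (p i x * p j x).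

Definition moment : 'cV[R]_N := \col_i \int[mu]_x (p i x * q x).

Lemma L2_mul_integrable (f g : T -> R) : f \in Lfun mu 2%:E -> g \in Lfun mu 2%:E ->
  mu.-integrable setT (EFin \o (fun x => f x * g x)).
Proof. by move=> f2 g2; apply/Lfun1_integrable; exact: Lfun2_mul_Lfun1. Qed.

Lemma L2_lincomb (c : 'cV[R]_N) : lin c \in Lfun mu 2%:E.
Proof.
have le12 : (1 <= 2%:E :> \bar R)%E by rewrite lee_fin ler1n.
have [L0 LD] := Lfun_submod_closed mu le12.
rewrite (_ : lin c = \sum_j c j 0 *: p j); last first.
  by apply/funext => x; rewrite fct_sumE.
by elim/big_ind: _ => // [f g fL gL|j _]; [rewrite -[f]scale1r LD|rewrite -[_ *: _]addr0 LD].
Qed.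

Lemma L2_sub (f g : T -> R) : f \in Lfun mu 2%:E -> g \in Lfun mu 2%:E ->
  (fun x => f x - g x) \in Lfun mu 2%:E.
Proof.
have le12 : (1 <= 2%:E :> \bar R)%E by rewrite lee_fin ler1n.
have [_ LD] := Lfun_submod_closed mu le12.
move=> fL gL; rewrite (_ : (fun x => f x - g x) = -1 *: g + f) ?LD//.
by apply/funext => x; rewrite /= scaleN1r addrC.
Qed.

Lemma Rintegral_lin_mul (c : 'cV[R]_N) (r : T -> R) : r \in Lfun mu 2%:E ->
  \int[mu]_x (lin c x * r x) = \sum_j c j 0 * \int[mu]_x (p j x * r x).
Proof.
(* The induction carries integrability of the partial sums along, as additivity of the real-valued
   integral requires it. *)
move=> rL; pose F (s : seq 'I_N) x := \sum_(j <- s) c j 0 * (p j x * r x).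
have iF j : mu.-integrable setT (EFin \o (fun x => c j 0 * (p j x * r x))).
  exact: (integrableZl measurableT (c j 0) (L2_mul_integrable (pL2 j) rL)).
have IF : forall s, mu.-integrable setT (EFin \o F s) /\
    \int[mu]_x F s x = \sum_(j <- s) c j 0 * \int[mu]_x (p j x * r x).
  elim=> [|j s [is_ Is]].
    rewrite (_ : F [::] = cst 0); last by apply/funext => x; rewrite /F big_nil.
    by split; [exact: integrable0|rewrite Rintegral_cst// mul0r big_nil].
  rewrite (_ : F (j :: s) = fun x => c j 0 * (p j x * r x) + F s x); last first.
    by apply/funext => x; rewrite /F big_cons.
  split; first exact: integrableD (iF j) is_.
  by rewrite RintegralD// RintegralZl ?big_cons ?Is//; exact: L2_mul_integrable.
rewrite -(IF _).2; apply: eq_Rintegral => x _.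
by rewrite mulr_suml; apply: eq_bigr => j _; rewrite mulrA.
Qed.

Lemma gram_mulE (c : 'cV[R]_N) (i : 'I_N) :
  (gram *m c) i 0 = \int[mu]_x (p i x * lin c x).
Proof.
under eq_Rintegral do rewrite mulrC.
rewrite Rintegral_lin_mul// mxE; apply: eq_bigr => j _.
rewrite mxE mulrC; congr (_ * _).
by apply: eq_Rintegral => x _; rewrite mulrC.
Qed.

(** Linear independence modulo null sets, with an explicit measurable witness. *)
Hypothesis lin_indep : forall c : 'cV[R]_N, c != 0 ->
  exists2 A, measurable A & mu A != 0%E /\ forall x, A x -> lin c x != 0.

Lemma lin_sqr_eq0 (c : 'cV[R]_N) : \int[mu]_x (lin c x ^+ 2) = 0 -> c = 0.
Proof.
move=> I0; apply/eqP; apply: contraT => /lin_indep[A mA [muA nA]].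
have ml : measurable_fun setT (lin c).
  by have := L2_lincomb c; rewrite inE => /andP[]; rewrite inE.
have il : mu.-integrable setT (EFin \o (fun x => lin c x ^+ 2)).
  exact: L2_mul_integrable (L2_lincomb c) (L2_lincomb c).
have : (\int[mu]_x `|(lin c x ^+ 2)%:E| = 0)%E.
  under eq_integral do rewrite /= ger0_norm ?sqr_ge0//.
  rewrite -[LHS]fineK; last exact: integrable_fin_num.
  by rewrite -/(Rintegral _ _ _) I0.
(* The combination vanishes off the null set B, so A lies inside B, against mu A != 0. *)
move/(ae_eq_integral_abs mu measurableT (measurable_int _ il)).1 => [B [mB muB nB]].
move: muA; rewrite -measure_le0 -muB => /negP[]; apply: le_measure; rewrite ?inE//.
move=> x Ax; apply: nB => /= /(_ I) [] /eqP; rewrite sqrf_eq0.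
by apply/negP; exact: nA.
Qed.

(** For v in the kernel, the quadratic form of [gram] at v is the integral of the squared
    combination; it vanishes, so v = 0. *)
Lemma gram_unitmx : gram \in unitmx.
Proof.
rewrite -unitmx_tr -row_free_unit -kermx_eq0; apply/eqP/row_matrixP => i; rewrite row0.
set v := row i _.
have : v *m gram^T = 0 by apply/sub_kermxP; exact: row_sub.
move=> /(congr1 trmx); rewrite trmx_mul trmxK trmx0 => vg.
apply: trmx_inj; rewrite trmx0; apply: lin_sqr_eq0.
under eq_Rintegral do rewrite expr2.
rewrite Rintegral_lin_mul; last exact: L2_lincomb.
by rewrite big1// => j _; rewrite -gram_mulE vg [X in _ * X]mxE mulr0.
Qed.

Definition sqr_dist c := (\int[mu]_x ((lin c x - q x) ^+ 2)%:E)%E.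

Lemma sqr_dist_fin c : sqr_dist c = (\int[mu]_x ((lin c x - q x) ^+ 2))%:E.
Proof.
rewrite /Rintegral fineK//; apply: integrable_fin_num => //.
by have r2 := L2_sub (L2_lincomb c) qL2; exact: (L2_mul_integrable r2 r2).
Qed.

(** The normal equations solved by c0 say that the residual lin c0 - q is orthogonal to every [p j],
    which kills the cross term. *)
Lemma sqr_dist_pythagoras c : let c0 := invmx gram *m moment in
  \int[mu]_x ((lin c x - q x) ^+ 2) =
  \int[mu]_x ((lin c0 x - q x) ^+ 2) + \int[mu]_x (lin (c - c0) x ^+ 2).
Proof.
move=> c0; set e := c - c0.
have r2 := L2_sub (L2_lincomb c0) qL2; have e2 := L2_lincomb e.
have irr := L2_mul_integrable r2 r2; have iee := L2_mul_integrable e2 e2.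
have ier := L2_mul_integrable e2 r2.
have cross : \int[mu]_x (lin e x * (lin c0 x - q x)) = 0.
  rewrite Rintegral_lin_mul// big1// => j _.
  under eq_Rintegral do rewrite mulrBr.
  rewrite RintegralB//; last 2 first.
  - exact: L2_mul_integrable (pL2 _) (L2_lincomb _).
  - exact: L2_mul_integrable.
  by rewrite -gram_mulE mulmxA mulmxV ?gram_unitmx// mul1mx [moment _ _]mxE subrr mulr0.
transitivity (\int[mu]_x (((lin c0 x - q x) ^+ 2 + lin e x ^+ 2)
    + 2 * (lin e x * (lin c0 x - q x)))).
  apply: eq_Rintegral => x _.
  have -> : lin c x = lin c0 x + lin e x.
    rewrite -big_split /=; apply: eq_bigr => j _.
    by rewrite -mulrDl [e _ _]mxE [(- c0) _ _]mxE subrKC.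
  ring.
rewrite RintegralD//; first last.
- exact: (integrableZl measurableT 2 ier).
- exact: integrableD irr iee.
by rewrite RintegralD// RintegralZl// cross mulr0 addr0.
Qed.

(** The excess error over c0 is the squared norm of lin (c - c0), zero only at c = c0. Uniqueness of
    the minimizer is what lets [xget] in [proj_coef] be evaluated. *)
Lemma sqr_dist_argmin c : (forall c', (sqr_dist c <= sqr_dist c')%E) <->
  c = invmx gram *m moment.
Proof.
split=> [cmin|-> c'].
  apply/eqP; rewrite -subr_eq0; apply/eqP/lin_sqr_eq0; apply/eqP.
  rewrite eq_le Rintegral_ge0 ?andbT; last by move=> x _; exact: sqr_ge0.
  have := cmin (invmx gram *m moment).
  by rewrite !sqr_dist_fin lee_fin sqr_dist_pythagoras gerDl.
rewrite !sqr_dist_fin lee_fin (sqr_dist_pythagoras c') lerDl.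
by apply: Rintegral_ge0 => x _; exact: sqr_ge0.
Qed.

End l2_projection.

(** The factors 1/L in the matrix and in the right-hand side cancel, so the coefficients depend on
    the samples through averages, to which the strong law applies. *)
Lemma ls_coef_normal_eq (R : realType) (n N : nat) (psi : 'I_N -> 'rV[R]_n -> R)
  (phi : 'rV[R]_n -> R) (y : nat -> 'rV[R]_n) (L : nat) :
  let A := \matrix_(i, j) ((\sum_(k < L) psi i (y k) * psi j (y k)) / L%:R) in
  let u := \col_i ((\sum_(k < L) psi i (y k) * phi (y k)) / L%:R) in
  (0 < L)%N -> A \in unitmx -> ls_coef psi phi y L = invmx A *m u.
Proof.
move=> A u L0 uA; set G := sample_mx psi y L.
have L0' : L%:R != 0 :> R by rewrite pnatr_eq0 -lt0n.
have AE : G^T *m G = L%:R *: A.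
  apply/matrixP => i j; rewrite !mxE mulrC divfK//.
  by apply: eq_bigr => k _; rewrite !mxE.
have uE : G^T *m sample_values phi y L = L%:R *: u.
  apply/matrixP => i j; rewrite !mxE mulrC divfK//.
  by apply: eq_bigr => k _; rewrite !mxE.
rewrite /ls_coef pinv_full_col_rank -/G AE; last by rewrite unitmxZ ?unitfE.
by rewrite -mulmxA uE invmxZ ?unitmxZ ?unitfE// -scalemxAl -scalemxAr scalerA mulVf// scale1r.
Qed.

(** * Almost sure convergence of the least-squares approximation *)

Theorem lemma1 (R : realType) (n N : nat)
  (X : set 'rV[R]_n) (mX : measurable X)
  (mu : probability 'rV[R]_n R) (muX : mu X = 1%E)
  (mu_equiv : forall A : set 'rV[R]_n, measurable A -> A `<=` X ->
     (mu A = 0%E <-> lebesgue_rV A = 0%E))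
  (psi : 'I_N -> 'rV[R]_n -> R)
  (psi_L2 : forall j, L2 mu X (psi j))
  (psi_indep : mu_independent mu X psi)
  (f : 'rV[R]_n -> 'rV[R]_n) (s : R -> 'rV[R]_n -> 'rV[R]_n)
  (f_hyp : hyperbolic_equilibrium f) (s_flow : is_flow f s)
  (lam : R[i]) (lam_gt0 : 0 < complex.Re lam)
  (w : 'rV[R[i]]_n) (w_eigen : left_eigenvector (linearization f) lam w)
  (eps : R) (eps_gt0 : 0 < eps) (t : 'rV[R]_n -> R)
  (t_ge0 : forall x, X x -> 0 <= t x)
  (t_near : forall x, X x -> euclid_norm (s (t x) x) < eps)
  (phi : 'rV[R]_n -> R) (phi_path : is_path_integral f s lam w t X phi)
  (phi_L2 : L2 mu X phi)
  (d : measure_display) (Om : measurableType d) (P : probability Om R)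
  (Y : nat -> {RV P >-> 'rV[R]_n})
  (Y_iid : iid_from mu Y) (Y_in : forall k om, X (Y k om)) :
  {ae P, forall om,
     ls_coef psi phi (fun k => Y k om) L @[L --> \oo]
       --> proj_coef mu X psi phi /\
     (forall x, X x ->
       ls_approx psi phi (fun k => Y k om) L x @[L --> \oo]
         --> L2_proj mu X psi phi x)}.
Proof.
(* Extension by zero turns integrals over X into integrals over the whole space; as the samples lie
   in X, the empirical sums are unchanged. *)
pose p j : 'rV[R]_n -> R := psi j \_ X; pose q : 'rV[R]_n -> R := phi \_ X.
have pE j x : X x -> p j x = psi j x by move=> Xx; rewrite /p patchE mem_set.
have qE x : X x -> q x = phi x by move=> Xx; rewrite /q patchE mem_set.
have pL2 j : p j \in Lfun mu 2%:E by exact: psi_L2.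
have qL2 : q \in Lfun mu 2%:E by exact: phi_L2.
have linE c x : X x -> lincomb p c x = lincomb psi c x.
  by move=> Xx; apply: eq_bigr => j _; rewrite pE.
have indep (c : 'cV[R]_N) : c != 0 -> exists2 A, measurable A &
    mu A != 0%E /\ forall x, A x -> \sum_j c j 0 * p j x != 0.
  move=> c0; have ml : measurable_fun setT (lincomb p c).
    by have := L2_lincomb pL2 c; rewrite inE => /andP[]; rewrite inE.
  have mZ : measurable (X `&` [set x | lincomb p c x = 0]).
    apply: measurableI => //; rewrite -[X in measurable X]setTI.
    exact: (ml measurableT _ (measurable_set1 0)).
  (* The witness is X without the zero set, which is null, so it has the full mass of X. *)
  exists (X `\` (X `&` [set x | lincomb p c x = 0])); first exact: measurableD.
  split; last by move=> x [Xx nZ]; apply/eqP => lx0; apply: nZ.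
  apply/eqP => A0; have := psi_indep c c0.
  rewrite (_ : X `&` _ = X `&` [set x | lincomb p c x = 0]); last first.
    by apply/seteqP; split=> x [Xx /=]; rewrite linE.
  set Z := [set x | _] => Z0.
  have : mu X = (mu (X `\` (X `&` Z)) + mu (X `&` (X `&` Z)))%E by exact: measureDI.
  by rewrite muX A0 setIA setIid Z0 add0e => -[] /eqP; rewrite oner_eq0.
have projE : proj_coef mu X psi phi = invmx (gram mu p) *m moment mu p q.
  have sqE c : sq_error mu X psi phi c = sqr_dist mu p q c.
    rewrite /sq_error integral_mkcond; apply: eq_integral => x _.
    rewrite patchE; case: ifPn => [/set_mem Xx|nX].
      by rewrite -(linE _ _ Xx) -qE.
    rewrite /q patchE (negbTE nX) subr0 big1 ?expr0n// => j _.
    by rewrite /p patchE (negbTE nX) mulr0.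
  apply: xget_unique => /=.
    move=> c; rewrite !sqE; move: c.
    exact/(sqr_dist_argmin pL2 qL2 indep).
  move=> c cmin; apply/(sqr_dist_argmin pL2 qL2 indep) => c'.
  by rewrite -!sqE; exact: cmin.
(* Finitely many pairs of indices share one null set. *)
have aeG : {ae P, forall om, forall i j,
    (\sum_(k < L) p i (Y k om) * p j (Y k om)) / L%:R @[L --> \oo] --> gram mu p i j}.
  apply: filter_forall => i; apply: filter_forall => j; rewrite mxE.
  exact: (iid_slln Y_iid (L2_mul_integrable (pL2 i) (pL2 j))).
have aem : {ae P, forall om, forall i,
    (\sum_(k < L) p i (Y k om) * q (Y k om)) / L%:R @[L --> \oo] --> moment mu p q i 0}.
  apply: filter_forall => i; rewrite mxE.
  exact: (iid_slln Y_iid (L2_mul_integrable (pL2 i) qL2)).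
apply: filterS2 aeG aem => om HG Hm.
pose A L : 'M[R]_N := \matrix_(i, j)
  ((\sum_(k < L) psi i (Y k om) * psi j (Y k om)) / L%:R).
pose u L : 'cV[R]_N := \col_i
  ((\sum_(k < L) psi i (Y k om) * phi (Y k om)) / L%:R).
have [uA Hc] : (\forall L \near \oo, A L \in unitmx) /\
    forall i, (invmx (A L) *m u L) i 0 @[L --> \oo]
      --> (invmx (gram mu p) *m moment mu p q) i 0.
  apply: cvg_invmx_mul; first exact: gram_unitmx pL2 indep.
    move=> i j; apply: cvg_trans (HG i j); apply: near_eq_cvg.
    apply: nearW => L; rewrite mxE; congr (_ / _).
    by apply: eq_bigr => k _; rewrite !pE.
  move=> i; apply: cvg_trans (Hm i); apply: near_eq_cvg.
  apply: nearW => L; rewrite mxE; congr (_ / _).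
  by apply: eq_bigr => k _; rewrite pE// qE.
(* For small L the empirical Gram matrix may be singular, and at L = 0 the averages are meaningless,
   so the identity is claimed only eventually. *)
have lsE : \forall L \near \oo,
    invmx (A L) *m u L = ls_coef psi phi (fun k => Y k om) L.
  near=> L; rewrite ls_coef_normal_eq//; last by near: L; exact: uA.
  by near: L; exists 1%N.
have ls_cvg i : ls_coef psi phi (fun k => Y k om) L i 0 @[L --> \oo]
    --> proj_coef mu X psi phi i 0.
  rewrite projE; apply: cvg_trans (Hc i); apply: near_eq_cvg.
  by apply: filterS lsE => L ->.
split; first by apply: cvg_mx_entries => i j; rewrite ord1; exact: ls_cvg.
move=> x _; rewrite /L2_proj /ls_approx /lincomb.
apply: cvg_big => [|j _]; first exact: add_continuous.
by apply: cvgM => //; exact: cvg_cst.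
Unshelve. all: by end_near. Qed.
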